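(* Let $1<\alpha<2$, $b>0$, $q\ge2$ an integer, $N=2^q$, $h=b/N$, $\kappa_\alpha=-1/(2\cos(\alpha\pi/2))$, and let $A_q=\frac{\kappa_\alpha}{h^{\alpha-1}\Gamma(4-\alpha)}B_h$ be the $(N-1)\times(N-1)$ matrix, where $B_h=(b_{i,j})$ is the symmetric matrix with $b_{i,i}=8-2^{4-\alpha}+\widetilde b_{i,i}$, $b_{i,i+1}=b_{i+1,i}=-7-3^{3-\alpha}+2^{5-\alpha}+\widetilde b_{i,i+1}$, and for $m=|j-i|\ge2$, $b_{i,j}=-(m+2)^{3-\alpha}+4(m+1)^{3-\alpha}-6m^{3-\alpha}+4(m-1)^{3-\alpha}-(m-2)^{3-\alpha}$, with $$\widetilde b_{i,i}=2\big[(i+1)^{3-\alpha}-2(3-\alpha)i^{2-\alpha}-(i-1)^{3-\alpha}\big]+2\big[(N-i+1)^{3-\alpha}-2(3-\alpha)(N-i)^{2-\alpha}-(N-i-1)^{3-\alpha}\big],$$ $$\widetilde b_{i,i+1}=-2\big[(i+1)^{3-\alpha}-i^{3-\alpha}\big]+(3-\alpha)\big[(i+1)^{2-\alpha}+i^{2-\alpha}\big]-2\big[(N-i)^{3-\alpha}-(N-i-1)^{3-\alpha}\big]+(3-\alpha)\big[(N-i)^{2-\alpha}+(N-i-1)^{2-\alpha}\big].$$ Let $D_q$ be the diagonal of $A_q$, let $\eta_0$ satisfy $\lambda_{\max}(D_q^{-1}A_q)\le\eta_0<2$, let $0<\omega<2/\eta_0$, let $0<\eta\le\omega(2-\omega\eta_0)$,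 and let $K_q=I-\omega D_q^{-1}A_q$. Then $\|K_q\nu\|_{A_q}^2\le\|\nu\|_{A_q}^2-\eta\|A_q\nu\|_{D_q^{-1}}^2$ for all $\nu\in\mathbb R^{N-1}$, and the two-grid iteration matrix satisfies $$\|K_qT^q\|_{A_q}\le\sqrt{1-2\eta/5}<1.$$
   Context: Here $0^p=0$ for $p>0$. For a symmetric positive definite $M$, $\|\nu\|_M=\sqrt{\nu^TM\nu}$ and for a matrix $X$, $\|X\|_M$ is the induced operator norm. The restriction $I_q^{q-1}:\mathbb R^{N-1}\to\mathbb R^{N/2-1}$ is $(I_q^{q-1}\nu)_i=\frac14(\nu_{2i-1}+2\nu_{2i}+\nu_{2i+1})$, $i=1,\dots,N/2-1$, and the prolongation is $I_{q-1}^q=2(I_q^{q-1})^T$. The coarse matrix is $A_{q-1}=I_q^{q-1}A_qI_{q-1}^q$ and the coarse grid correction operator is $T^q=I-I_{q-1}^qA_{q-1}^{-1}I_q^{q-1}A_q$. $K_q$ is the damped Jacobi iteration matrix; $K_qT^q$ is the two-grid method (TGM) iteration matrix. *)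

(* Defs.v *)
From HB Require Import structures.
From mathcomp Require Import all_boot all_order all_algebra.
From mathcomp Require Import all_classical all_reals all_analysis.
Set Implicit Arguments. Unset Strict Implicit. Unset Printing Implicit Defensive.
Import Order.TTheory GRing.Theory Num.Theory.
Local Open Scope ring_scope.
Local Open Scope classical_set_scope.

Section Defs.
Variable R : realType.

Definition Gamma (x : R) : R :=
  Rintegral lebesgue_measure `[0%R, +oo[ (fun t : R => t `^ (x - 1) * expR (- t)).

(* k^p for a natural k (with 0^p = 0 for p > 0, as powR does) *)
Definition pw (k : nat) (p : R) : R := (k%:R : R) `^ p.

(* entries of B_h, with 1-based indices i, j and N = 2^q *)
Definition bt_diag (a : R) (N i : nat) : R :=
  2 * (pw i.+1 (3 - a) - 2 * (3 - a) * pw i (2 - a) - pw i.-1 (3 - a))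
  + 2 * (pw (N - i).+1 (3 - a) - 2 * (3 - a) * pw (N - i) (2 - a)
         - pw (N - i - 1) (3 - a)).

Definition bt_off (a : R) (N i : nat) : R :=
  - 2 * (pw i.+1 (3 - a) - pw i (3 - a))
  + (3 - a) * (pw i.+1 (2 - a) + pw i (2 - a))
  - 2 * (pw (N - i) (3 - a) - pw (N - i - 1) (3 - a))
  + (3 - a) * (pw (N - i) (2 - a) + pw (N - i - 1) (2 - a)).

Definition b_entry (a : R) (N i j : nat) : R :=
  let m := (if i <= j then j - i else i - j)%N in
  if m == 0%N then 8 - 2 `^ (4 - a) + bt_diag a N i
  else if m == 1%N then
    - 7 - 3 `^ (3 - a) + 2 `^ (5 - a) + bt_off a N (minn i j)
  else - pw m.+2 (3 - a) + 4 * pw m.+1 (3 - a) - 6 * pw m (3 - a)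
       + 4 * pw m.-1 (3 - a) - pw (m - 2) (3 - a).

(* B_h as an (N-1)x(N-1) matrix; the 0-based index i stands for i+1 *)
Definition Bh (a : R) (q : nat) : 'M[R]_((2 ^ q).-1) :=
  \matrix_(i, j) b_entry a (2 ^ q) i.+1 j.+1.

Definition kappa (a : R) : R := - 1 / (2 * cos (a * pi / 2)).

Definition Aq (a b : R) (q : nat) : 'M[R]_((2 ^ q).-1) :=
  (kappa a / ((b / (2 ^ q)%:R) `^ (a - 1) * Gamma (4 - a))) *: Bh a q.

Definition diagpart n (A : 'M[R]_n) : 'M[R]_n := diag_mx (\row_i A i i).

Definition restr (q : nat) : 'M[R]_((2 ^ q %/ 2).-1, (2 ^ q).-1) :=
  \matrix_(i, j) (if j == (2 * i)%N :> nat then 1 / 4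
                  else if j == (2 * i).+1 :> nat then 2 / 4
                  else if j == (2 * i).+2 :> nat then 1 / 4 else 0).

Definition prol (q : nat) : 'M[R]_((2 ^ q).-1, (2 ^ q %/ 2).-1) :=
  2 *: (restr q)^T.

(* coarse grid correction operator T^q = I - P A_{q-1}^{-1} R A_q *)
Definition cgc (q : nat) (A : 'M[R]_((2 ^ q).-1)) : 'M[R]_((2 ^ q).-1) :=
  1%:M - prol q *m invmx (restr q *m A *m prol q) *m restr q *m A.

Definition jacobi n (w : R) (A : 'M[R]_n) : 'M[R]_n :=
  1%:M - w *: (invmx (diagpart A) *m A).

Definition mnorm n (M : 'M[R]_n) (v : 'cV[R]_n) : R :=
  Num.sqrt (((v^T *m M *m v) 0 0)).

Definition opnorm n (M X : 'M[R]_n) : R :=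
  sup [set mnorm M (X *m v) / mnorm M v | v in [set v : 'cV[R]_n | v != 0]].

(* lambda_max(X) <= e : every (necessarily real) eigenvalue of X is <= e *)
Definition lmax_le n (X : 'M[R]_n) (e : R) : Prop :=
  forall l : R, eigenvalue X l -> l <= e.

End Defs.

(* Main.v *)
Require Import Defs.
From HB Require Import structures.
From mathcomp Require Import all_boot all_order all_algebra.
From mathcomp Require Import all_classical all_reals all_analysis.
From mathcomp Require Import zify ring lra.
Import Order.TTheory GRing.Theory Num.Theory numFieldNormedType.Exports.
Local Open Scope ring_scope.
Local Open Scope classical_set_scope.
Set Implicit Arguments.
Unset Strict Implicit.
Unset Printing Implicit Defensive.

(* With p = 3 - a in (1, 2), mean-value arguments on x ^ p show that B_h has
   nonpositive off-diagonal entries and positive row sums.  Its quadratic form is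
   therefore a graph energy plus a positive potential, so B_h is positive definite.
   Moreover every diagonal entry is at most five times the weight of an adjacent
   edge, and in the two boundary rows at most five times the row sum.  Comparing a
   grid function at its fine points with the average of its two neighbours uses
   each of these edges once, which gives the approximation property
   |x - P mu|_D ^ 2 <= 5 / 2 |x|_A ^ 2.  Since the image of the coarse correction is
   A-orthogonal to the range of P, Cauchy-Schwarz combines this with the smoothing
   property into the contraction factor 1 - 2 eta / 5.  The smoothing property is
   the bound of the Rayleigh quotient by the largest eigenvalue.  A_q is a
   nonnegative multiple of B_h, and everything is trivial when the factor is 0. *)

(** * Differences of powers *)

Section Calculus.
Variable R : realType.
Implicit Types (f df : R -> R) (x c : R).

Lemma mean_value f df (a b : R) : a < b ->
  (forall x, a < x < b -> is_derive x 1 f (df x)) ->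
  (forall x, a <= x <= b -> {for x, continuous f}) ->
  exists2 c, a < c < b & f b - f a = df c * (b - a).
Proof.
move=> ab Hd Hc.
have fc : {within `[a, b], continuous f}.
  by apply: continuous_in_subspaceT => x; rewrite inE /= in_itv => /Hc.
have fd x : x \in `]a, b[%R -> is_derive x 1 f (df x) by rewrite in_itv => /Hd.
have [c cab ->] := MVT ab fd fc.
by exists c => //; move: cab; rewrite in_itv.
Qed.

Lemma is_derive_translate f x c d :
  is_derive (x + c) 1 f d -> is_derive x 1 (fun y => f (y + c)) d.
Proof.
move=> H.
have H2 : is_derive x (1:R) (fun y : R => y + c) 1.
  by apply: is_derive_eq; rewrite addr0.
have := @is_derive1_comp R f (fun y => y + c) x d 1 H H2.
by rewrite mulr1.
Qed.

Lemma is_derive_continuous f x d : is_derive x 1 f d -> {for x, continuous f}.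
Proof. by case=> /derivable1_diffP/differentiable_continuous. Qed.

Lemma continuous_translate f x c :
  {for x + c, continuous f} -> {for x, continuous (fun y => f (y + c))}.
Proof.
move=> H; apply: (@continuous_comp _ _ _ (fun y => y + c) f) => //.
by apply: continuousD; [exact: cvg_id | exact: cst_continuous].
Qed.

(** [powR] is not continuous at [0] from the left. With the absolute value the power is continuous
    on the whole line, which matters because the differences below reach down to the argument
    [0]. *)
Lemma norm_powR_continuous (p : R) : 0 < p -> continuous (fun x : R => `|x| `^ p).
Proof.
move=> p0 x; have [->|x0] := eqVneq x 0; last first.
  apply: (@continuous_comp _ _ _ (fun y : R => `|y|) (fun y => y `^ p)).
    exact: norm_continuous.
  apply: is_derive_continuous; apply: is_derive1_powR; by rewrite normr_gt0.
rewrite /continuous_at normr0 powR0 ?gt_eqF//.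
apply/cvgrPdist_lt => e e0.
have e1 : 0 < e `^ p^-1 by rewrite powR_gt0.
exists (e `^ p^-1) => //= y /=; rewrite sub0r normrN sub0r normrN => ye.
rewrite ger0_norm ?powR_ge0//.
have -> : e = (e `^ p^-1) `^ p by rewrite -powRrM mulVf ?gt_eqF// powRr1 // ltW.
by apply: gt0_ltr_powR => //; rewrite nnegrE // ltW.
Qed.

Lemma norm_powR_is_derive (p x : R) : 0 < x ->
  is_derive x 1 (fun x : R => `|x| `^ p) (p * x `^ (p - 1)).
Proof.
move=> x0; apply: (@near_eq_is_derive _ _ _ (fun x => x `^ p)).
  near=> y; rewrite ger0_norm //; apply: ltW; near: y.
  exact: lt_nbhsr.
exact: is_derive1_powR.
Unshelve. all: by end_near.
Qed.

(** * Differences of a function whose second derivative decreases and is convex *)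

Section ThirdOrder.
Variables f f1 f2 : R -> R.
Hypothesis f_cont : continuous f.
Hypothesis f_der : forall x, 0 < x -> is_derive x 1 f (f1 x).
Hypothesis f1_der : forall x, 0 < x -> is_derive x 1 f1 (f2 x).
Hypothesis f2_decr : forall x y, 0 < x -> x <= y -> f2 y <= f2 x.
Hypothesis f2_conv : forall x, 1 < x -> 0 < f2 (x + 1) - 2 * f2 x + f2 (x - 1).

Let f_at x : {for x, continuous f}. Proof. exact: f_cont. Qed.
Let f1_at x : 0 < x -> {for x, continuous f1}.
Proof. by move=> x0; apply: is_derive_continuous (f1_der x0). Qed.

(** Since [f2] decreases, [f1] is concave, and the trapezoidal rule underestimates its integral over
    [[k, k + 1]]. The defect [u] of the rule, as a function of the interval length, has nonnegative
    derivative. *)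
Lemma trapezoid_le k : 1 <= k -> f1 (k + 1) + f1 k <= 2 * (f (k + 1) - f k).
Proof.
move=> k1.
pose u t := 2 * f (t + k) - t * (f1 (t + k) + f1 k).
have uD t : 0 < t + k -> is_derive t 1 u (f1 (t + k) - f1 k - t * f2 (t + k)).
  move=> tk.
  have H1 := is_derive_translate (f_der tk).
  have H2 := is_derive_translate (f1_der tk).
  by apply: is_derive_eq; rewrite /= !scaler1 /GRing.scale /=; ring.
have [|t||c /andP[c0 c1]] := @mean_value u (fun t => f1 (t + k) - f1 k - t * f2 (t + k)) 0 1.
- exact: ltr01.
- by move=> /andP[t0 _]; apply: uD; lra.
- by move=> t /andP[t0 _]; apply: is_derive_continuous; apply: uD; lra.
have [|t||d /andP[d0 dc]] := @mean_value (fun t => f1 (t + k)) (fun t => f2 (t + k)) 0 c.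
- exact: c0.
- by move=> /andP[t0 _]; apply: is_derive_translate; apply: f1_der; lra.
- by move=> t /andP[t0 _]; apply: continuous_translate; apply: f1_at; lra.
rewrite add0r => e1; rewrite e1 /u !add0r (addrC 1 k) => e2.
have := @f2_decr (d + k) (c + k).
have : 0 < d + k by lra.
move=> h /(_ h) {}h; have {}h : f2 (c + k) <= f2 (d + k) by apply: h; lra.
nra.
Qed.

(** The midpoint rule overestimates the integral of the concave [f1]. For [k = 1] the interval ends
    at [0], where only continuity of [f] is available. *)
Lemma central_difference_le k : 1 <= k -> f (k + 1) - f (k - 1) <= 2 * f1 k.
Proof.
move=> k1.
pose u t := f (t + k) - f (- t + k) - 2 * t * f1 k.
have uD t : 0 < t + k -> 0 < - t + k -> is_derive t 1 u (f1 (t + k) + f1 (- t + k) - 2 * f1 k).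
  move=> tk tk'.
  have H1 := is_derive_translate (f_der tk).
  have H2 : is_derive t 1 (fun t => f (- t + k)) (f1 (- t + k) * -1).
    apply: (@is_derive1_comp R (fun y => f (y + k)) (fun y => - y)).
    exact: is_derive_translate (f_der tk').
  by apply: is_derive_eq; rewrite /= !scaler1 /GRing.scale /=; ring.
have u_at t : {for t, continuous u}.
  apply: continuousB; last first.
    apply: continuousM; last exact: cst_continuous.
    by apply: continuousM; [exact: cst_continuous | exact: cvg_id].
  apply: continuousB; first exact: continuous_translate.
  apply: (@continuous_comp _ _ _ (fun y => - y) (fun y => f (y + k))).
    exact: oppr_continuous.
  exact: continuous_translate.
have [|t||c /andP[c0 c1]] :=
  @mean_value u (fun t => f1 (t + k) + f1 (- t + k) - 2 * f1 k) 0 1.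
- exact: ltr01.
- by move=> /andP[t0 t1]; apply: uD; lra.
- by move=> t _; exact: u_at.
(* Applied to a difference of two translates of [f1], the mean value theorem turns
   [f1 (k + c) - 2 * f1 k + f1 (k - c)] into [c] times a difference of two values of [f2]. *)
have [|t||d /andP[d0 dc]] := @mean_value (fun t => f1 (t + k) - f1 (t + (k - c)))
    (fun t => f2 (t + k) - f2 (t + (k - c))) 0 c.
- exact: c0.
- move=> /andP[t0 _]; apply: is_deriveB; apply: is_derive_translate; apply: f1_der; lra.
- move=> t /andP[t0 _]; apply: continuousB; apply: continuous_translate; apply: f1_at; lra.
have -> : c + (k - c) = k by ring.
rewrite !add0r => e1; rewrite /u oppr0 !add0r (addrC 1 k) (addrC (-1) k) (addrC (- c) k) => e2.
have dkc : 0 < d + (k - c) by lra.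
have := f2_decr dkc (_ : d + (k - c) <= d + k).
have -> : d + (k - c) <= d + k by lra.
move=> /(_ isT).
nra.
Qed.

Let k3 g x : R := g (x + 1) - 3 * g x + 3 * g (x - 1) - g (x - 2).
Let h2 g x : R := g (x + 1) - 2 * g x + g (x - 1).

Let k3_der g g1 x :
  (forall x, 0 < x -> is_derive x 1 g (g1 x)) -> 2 < x -> is_derive x 1 (k3 g) (k3 g1 x).
Proof.
move=> gD x2.
have H1 : is_derive x 1 (fun y => g (y + 1)) (g1 (x + 1)).
  by apply: is_derive_translate; apply: gD; lra.
have H2 : is_derive x 1 (fun y => g (y - 1)) (g1 (x - 1)).
  by apply: is_derive_translate; apply: gD; lra.
have H3 : is_derive x 1 (fun y => g (y - 2)) (g1 (x - 2)).
  by apply: is_derive_translate; apply: gD; lra.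
have H4 : is_derive x 1 g (g1 x) by apply: gD; lra.
by apply: is_derive_eq; rewrite /k3 /GRing.scale /=; ring.
Qed.

Let h2_der g g1 x :
  (forall x, 0 < x -> is_derive x 1 g (g1 x)) -> 1 < x -> is_derive x 1 (h2 g) (h2 g1 x).
Proof.
move=> gD x2.
have H1 : is_derive x 1 (fun y => g (y + 1)) (g1 (x + 1)).
  by apply: is_derive_translate; apply: gD; lra.
have H2 : is_derive x 1 (fun y => g (y - 1)) (g1 (x - 1)).
  by apply: is_derive_translate; apply: gD; lra.
have H4 : is_derive x 1 g (g1 x) by apply: gD; lra.
by apply: is_derive_eq; rewrite /h2 /GRing.scale /=; ring.
Qed.

Let h2_at x : {for x, continuous (h2 f)}.
Proof.
apply: continuousD; last exact: continuous_translate.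
apply: continuousB; first exact: continuous_translate.
by apply: continuousM; [exact: cst_continuous|exact: f_at].
Qed.

Let k3E g x : k3 g x = h2 g x - h2 g (x - 1).
Proof.
rewrite /k3 /h2; have -> : x - 1 + 1 = x by ring.
by have -> : x - 1 - 1 = x - 2; ring.
Qed.

(** The left side is [h2 f x - h2 f (x - 1)], hence [h2 f1 c] for some [c < x]. Convexity of [f2]
    makes [h2 f1] increasing. *)
Lemma third_difference_lt_derivative x : 2 <= x ->
  f (x + 1) - 3 * f x + 3 * f (x - 1) - f (x - 2) < f1 (x + 1) - 2 * f1 x + f1 (x - 1).
Proof.
move=> x2.
have [|t||c /andP[c0 c1]] := @mean_value (h2 f) (h2 f1) (x - 1) x.
- lra.
- by move=> /andP[t0 _]; apply: h2_der => //; lra.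
- by move=> t _; exact: h2_at.
have [|t||d /andP[d0 dc]] := @mean_value (h2 f1) (h2 f2) c x.
- lra.
- by move=> /andP[t0 _]; apply: h2_der => //; lra.
- by move=> t /andP[t0 _]; apply: is_derive_continuous (h2_der f1_der _); lra.
have d1 : 1 < d by lra.
have := f2_conv d1; rewrite -/(h2 f2 d) => hd.
have : 0 < h2 f2 d * (x - c) by apply: mulr_gt0 => //; lra.
by rewrite -/(k3 f x) -/(h2 f1 x) k3E; lra.
Qed.

(** Two mean value steps write the fourth difference of [f] as [h2 f2 d], positive by convexity. The
    bound [2 <= x] ensures [1 < d]. *)
Lemma fourth_difference_gt0 x : 2 <= x ->
  0 < f (x + 2) - 4 * f (x + 1) + 6 * f x - 4 * f (x - 1) + f (x - 2).
Proof.
move=> x2.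
have k3_at t : {for t, continuous (k3 f)}.
  apply: continuousB; last exact: continuous_translate.
  apply: continuousD; last first.
    by apply: continuousM; [exact: cst_continuous|exact: continuous_translate].
  apply: continuousB; first exact: continuous_translate.
  by apply: continuousM; [exact: cst_continuous|exact: f_at].
have [|t||c /andP[c0 c1]] := @mean_value (k3 f) (k3 f1) x (x + 1).
- lra.
- by move=> /andP[t0 _]; apply: k3_der => //; lra.
- by move=> t _; exact: k3_at.
have [|t||d /andP[d0 dc]] := @mean_value (h2 f1) (h2 f2) (c - 1) c.
- lra.
- by move=> /andP[t0 _]; apply: h2_der => //; lra.
- by move=> t /andP[t0 _]; apply: is_derive_continuous (h2_der f1_der _); lra.
have d1 : 1 < d by lra.
have := f2_conv d1; rewrite -/(h2 f2 d) => hd.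
rewrite -k3E (_ : c - (c - 1) = 1) ?mulr1; last by ring.
move=> ->; rewrite (_ : x + 1 - x = 1) ?mulr1; last by ring.
move=> e; rewrite -e in hd; move: hd; rewrite /k3.
have -> : x + 1 + 1 = x + 2 by ring.
have -> : x + 1 - 1 = x by ring.
have -> : x + 1 - 2 = x - 1 by ring.
lra.
Qed.
End ThirdOrder.

(** * The power function with exponent between 1 and 2 *)

Variable p : R.
Hypothesis p12 : 1 < p < 2.
Let F (x : R) := `|x| `^ p.
Let F1 (x : R) := p * x `^ (p - 1).
Let F2 (x : R) := p * ((p - 1) * x `^ (p - 2)).

Let F_cont : continuous F.
Proof. by apply: norm_powR_continuous; case/andP: p12; lra. Qed.

Let F_der x : 0 < x -> is_derive x 1 F (F1 x).
Proof. by move=> x0; apply: norm_powR_is_derive. Qed.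

Let F1_der x : 0 < x -> is_derive x 1 F1 (F2 x).
Proof.
move=> x0; have H := is_derive1_powR (p - 1) x0.
by apply: is_derive_eq; rewrite /F2 /GRing.scale /= (_ : p - 1 - 1 = p - 2); ring.
Qed.

Let pp1_gt0 : 0 < p * (p - 1).
Proof. by case/andP: p12 => p1 p2; apply: mulr_gt0; lra. Qed.

Let powR_neg_decr (r x y : R) : r < 0 -> 0 < x -> x < y -> y `^ r < x `^ r.
Proof.
move=> r0 x0 xy; have y0 : 0 < y by exact: lt_trans xy.
rewrite -[r]opprK (powRN y) (powRN x) ltf_pV2 ?posrE ?powR_gt0//.
by apply: gt0_ltr_powR; rewrite ?nnegrE ?oppr_gt0// ltW.
Qed.

Let F2_decr x y : 0 < x -> x <= y -> F2 y <= F2 x.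
Proof.
move=> x0; rewrite le_eqVlt => /predU1P[->//|xy].
rewrite /F2 !mulrA; apply: ler_wpM2l; first exact: ltW.
by apply/ltW/powR_neg_decr => //; case/andP: p12; lra.
Qed.

(** By the arithmetic-geometric mean inequality the two outer powers sum to at least twice the power
    of [(x + 1) * (x - 1)] with exponent [(p - 2) / 2]. As [x ^ 2 - 1 < x ^ 2] and the exponent is
    negative, this exceeds the middle term. *)
Let F2_conv x : 1 < x -> 0 < F2 (x + 1) - 2 * F2 x + F2 (x - 1).
Proof.
move=> x1.
suff H : 0 < (x + 1) `^ (p - 2) - 2 * x `^ (p - 2) + (x - 1) `^ (p - 2).
  by have := mulr_gt0 pp1_gt0 H; rewrite /F2; lra.
have r0 : p - 2 < 0 by case/andP: p12; lra.
have h y : y `^ (p - 2) = (y `^ ((p - 2) / 2)) ^+ 2.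
  by rewrite -powR_mulrn ?powR_ge0// -powRrM; congr (_ `^ _); field.
have : (x + 1) `^ ((p - 2) / 2) * (x - 1) `^ ((p - 2) / 2) > x `^ (p - 2).
  rewrite -powRM; try lra.
  rewrite (_ : x `^ (p - 2) = (x * x) `^ ((p - 2) / 2)); last first.
    by rewrite powRM; try lra; rewrite h expr2.
  apply: powR_neg_decr; first lra.
    by apply: mulr_gt0; lra.
  lra.
rewrite (h (x + 1)) (h (x - 1)).
by have := sqr_ge0 ((x + 1) `^ ((p - 2) / 2) - (x - 1) `^ ((p - 2) / 2)); lra.
Qed.

Let F_pos x : 0 <= x -> F x = x `^ p.
Proof. by move=> x0; rewrite /F ger0_norm. Qed.

Lemma powR_trapezoid_le k : 1 <= k ->
  p * (k + 1) `^ (p - 1) + p * k `^ (p - 1) <= 2 * ((k + 1) `^ p - k `^ p).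
Proof.
move=> k1; have := trapezoid_le F_der F1_der F2_decr k1.
by rewrite /F1 !F_pos; lra.
Qed.

Lemma powR_central_difference_le k : 1 <= k ->
  (k + 1) `^ p - (k - 1) `^ p <= 2 * (p * k `^ (p - 1)).
Proof.
move=> k1; have := central_difference_le F_cont F_der F1_der F2_decr k1.
by rewrite /F1 !F_pos; lra.
Qed.

Lemma powR_third_difference_lt k : 2 <= k ->
  (k + 1) `^ p - 3 * k `^ p + 3 * (k - 1) `^ p - (k - 2) `^ p
    < p * (k + 1) `^ (p - 1) - 2 * (p * k `^ (p - 1)) + p * (k - 1) `^ (p - 1).
Proof.
move=> k1; have := third_difference_lt_derivative F_cont F_der F1_der F2_conv k1.
by rewrite /F1 !F_pos; lra.
Qed.

Lemma powR_fourth_difference_gt0 k : 2 <= k ->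
  0 < (k + 2) `^ p - 4 * (k + 1) `^ p + 6 * k `^ p - 4 * (k - 1) `^ p + (k - 2) `^ p.
Proof.
move=> k1; have := fourth_difference_gt0 F_cont F_der F1_der F2_conv k1.
by rewrite /F1 !F_pos; lra.
Qed.

Let natrD1 (k : nat) : (k.+1%:R : R) = k%:R + 1. Proof. by rewrite natr1. Qed.

Lemma pw_trapezoid_le (k : nat) : (1 <= k)%N ->
  p * pw k.+1 (p - 1) + p * pw k (p - 1) <= 2 * (pw k.+1 p - pw k p).
Proof. by move=> k1; rewrite /pw natrD1; apply: powR_trapezoid_le; rewrite ler1n. Qed.

Lemma pw_central_difference_le (k : nat) : (1 <= k)%N ->
  pw k.+1 p - pw k.-1 p <= 2 * (p * pw k (p - 1)).
Proof.
case: k => // k _; have := @powR_central_difference_le k.+1%:R.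
have -> : k.+1%:R - 1 = k%:R :> R by rewrite natrD1 addrK.
by rewrite /pw -natrD1 ler1n; apply.
Qed.

Lemma pw_third_difference_lt (k : nat) : (2 <= k)%N ->
  pw k.+1 p - 3 * pw k p + 3 * pw k.-1 p - pw (k - 2) p
    < p * pw k.+1 (p - 1) - 2 * (p * pw k (p - 1)) + p * pw k.-1 (p - 1).
Proof.
case: k => [|[|k]] // _; have := @powR_third_difference_lt k.+2%:R.
rewrite ler_nat /pw subSS subn1 /= -natrD1 => /(_ isT).
have -> : k.+2%:R - 1 = k.+1%:R :> R by rewrite [in LHS]natrD1 addrK.
by have -> : k.+2%:R - 2 = k%:R :> R by rewrite !natrD1; ring.
Qed.

Lemma pw_fourth_difference_gt0 (k : nat) : (2 <= k)%N ->
  0 < pw k.+2 p - 4 * pw k.+1 p + 6 * pw k p - 4 * pw k.-1 p + pw (k - 2) p.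
Proof.
case: k => [|[|k]] // _; have := @powR_fourth_difference_gt0 k.+2%:R.
rewrite ler_nat /pw subSS subn1 /= => /(_ isT).
have -> : k.+2%:R - 1 = k.+1%:R :> R by rewrite [in LHS]natrD1 addrK.
have -> : k.+2%:R - 2 = k%:R :> R by rewrite !natrD1; ring.
have -> : k.+2%:R + 2 = k.+4%:R :> R by rewrite !natrD1; ring.
by rewrite natr1.
Qed.

(* With [y = 2 ^ ((p - 2) / 5) <= 1], the bound [3 ^ 5 < 2 ^ 8] gives
   [3 ^ (p - 2) >= y ^ 8], and [5 y^8 - 8 y^5 + 3] has a double root at [1]. *)
Lemma powR2_powR3_le : 18 * 2 `^ p <= 5 * 3 `^ p + 27.
Proof.
have /andP[p1 p2] := p12.
pose y : R := 2 `^ ((p - 2) / 5).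
have y0 : 0 < y by rewrite powR_gt0.
have e2 : 2 `^ p = 4 * y ^+ 5.
  rewrite /y -powR_mulrn ?powR_ge0// -powRrM (_ : (p - 2) / 5 * 5 = p - 2); last by field.
  rewrite powRB ?pnatr_eq0 ?implybT// (_ : (2 : R) `^ 2 = 4).
    by field.
  by rewrite -[X in _ `^ X]/(2%:R) powR_mulrn// ; ring.
have e3 : 9 * y ^+ 8 <= 3 `^ p.
  have -> : 3 `^ p = 9 * 3 `^ (p - 2) :> R.
    rewrite powRB ?pnatr_eq0 ?implybT// (_ : (3 : R) `^ 2 = 9).
      by field.
    by rewrite -[X in _ `^ X]/(2%:R) powR_mulrn// ; ring.
  rewrite ler_pM2l; last by lra.
  have -> : y ^+ 8 = (2 ^+ 8) `^ ((p - 2) / 5).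
    by rewrite /y -!powR_mulrn ?powR_ge0// powRAC.
  have -> : (3 : R) `^ (p - 2) = (3 ^+ 5) `^ ((p - 2) / 5).
    rewrite -powR_mulrn// -powRrM; congr (_ `^ _); by field.
  by apply/ltW/powR_neg_decr; lra.
have : 0 <= 5 * y ^+ 8 - 8 * y ^+ 5 + 3.
  have -> : 5 * y ^+ 8 - 8 * y ^+ 5 + 3 =
    (y - 1) ^+ 2 * (5 * y ^+ 6 + 10 * y ^+ 5 + 15 * y ^+ 4 + 12 * y ^+ 3 + 9 * y ^+ 2 + 6 * y + 3).
    by ring.
  apply: mulr_ge0; first exact: sqr_ge0.
  by rewrite !addr_ge0 ?mulr_ge0 ?exprn_ge0// ltW.
rewrite e2; lra.
Qed.
End Calculus.

(** * Quadratic forms and the two-grid estimate *)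

Section BilinearForms.
Variable R : realType.

Definition bform n (M : 'M[R]_n) (x y : 'cV[R]_n) : R := (x^T *m M *m y) 0 0.

(** Symmetry is not included and is always stated separately. *)
Definition posdef n (M : 'M[R]_n) := forall x : 'cV[R]_n, x != 0 -> 0 < bform M x x.

Section Fixed.
Variable n : nat.
Implicit Types (M D A : 'M[R]_n) (x y z : 'cV[R]_n).

Lemma bformDl M x y z : bform M (x + y) z = bform M x z + bform M y z.
Proof. by rewrite /bform linearD !mulmxDl mxE. Qed.

Lemma bformDr M x y z : bform M z (x + y) = bform M z x + bform M z y.
Proof. by rewrite /bform mulmxDr mxE. Qed.

Lemma bformZl M c x y : bform M (c *: x) y = c * bform M x y.
Proof. by rewrite /bform linearZ -!scalemxAl mxE. Qed.

Lemma bformZr M c x y : bform M x (c *: y) = c * bform M x y.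
Proof. by rewrite /bform -scalemxAr mxE. Qed.

Lemma bform0l M y : bform M 0 y = 0.
Proof. by rewrite /bform trmx0 !mul0mx mxE. Qed.

Lemma bformBm M D x y : bform (M - D) x y = bform M x y - bform D x y.
Proof. by rewrite /bform mulmxBr mulmxBl !mxE. Qed.

Lemma bformZm M c x y : bform (c *: M) x y = c * bform M x y.
Proof. by rewrite /bform -scalemxAr -scalemxAl mxE. Qed.

Lemma bform_sym M x y : M^T = M -> bform M x y = bform M y x.
Proof.
move=> Ms; rewrite /bform -[in LHS](trmxK (x^T *m M *m y)) mxE.
by rewrite !trmx_mul trmxK Ms mulmxA.
Qed.

Lemma bformE M x y : bform M x y = \sum_i \sum_j M i j * (x i 0 * y j 0).
Proof.
rewrite /bform -mulmxA mxE; apply: eq_bigr => i _.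
rewrite !mxE mulr_sumr; apply: eq_bigr => j _; ring.
Qed.

Lemma bform1E x : bform 1%:M x x = \sum_i x i 0 ^+ 2.
Proof.
rewrite /bform mulmx1 mxE; apply: eq_bigr => i _; by rewrite mxE expr2.
Qed.

Lemma posdef_ge0 M x : posdef M -> 0 <= bform M x x.
Proof.
move=> Mp; have [->|/Mp/ltW//] := eqVneq x 0.
by rewrite bform0l.
Qed.

Lemma posdef_unitmx M : posdef M -> M \in unitmx.
Proof.
move=> Mp; rewrite unitmxE unitfE; apply/negP => /det0P[v v0 vM].
have : v^T != 0 by rewrite -(inj_eq (@trmx_inj _ _ _)) trmxK trmx0.
by move=> /Mp; rewrite /bform trmxK vM mul0mx mxE ltxx.
Qed.

Lemma bform_CauchySchwarz M x y : M^T = M -> (forall z, 0 <= bform M z z) ->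
  bform M x y ^+ 2 <= bform M x x * bform M y y.
Proof.
move=> Ms Mp.
have H t : 0 <= bform M x x + 2 * t * bform M x y + t ^+ 2 * bform M y y.
  have := Mp (x + t *: y).
  rewrite bformDl !bformDr !bformZl !bformZr (bform_sym y x Ms).
  by congr (0 <= _); ring.
have [y0|yn0] := eqVneq (bform M y y) 0; last first.
  have y0 : 0 < bform M y y by rewrite lt_def yn0 Mp.
  have := H (- bform M x y / bform M y y).
  have -> : bform M x x + 2 * (- bform M x y / bform M y y) * bform M x y
     + (- bform M x y / bform M y y) ^+ 2 * bform M y y
    = (bform M x x * bform M y y - bform M x y ^+ 2) / bform M y y by field.
  by rewrite pmulr_lge0 ?invr_gt0// subr_ge0.
have [->|xy0] := eqVneq (bform M x y) 0.
  by rewrite expr0n /= mulr_ge0.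
(* When [bform M y y = 0] the quadratic in [t] is affine, and this value of [t] makes it [-1]. *)
have := H (- (bform M x x + 1) / (2 * bform M x y)).
rewrite y0 mulr0 addr0.
have -> : bform M x x + 2 * (- (bform M x x + 1) / (2 * bform M x y)) * bform M x y = -1.
  by field.
by rewrite lerNr oppr0 ler10.
Qed.

Lemma bform_bounded M : exists2 C, 0 < C &
  forall x, bform M x x <= C * bform 1%:M x x.
Proof.
exists (\sum_i \sum_j `|M i j| + 1).
  by rewrite ltr_wpDl// sumr_ge0// => i _; rewrite sumr_ge0.
move=> x; rewrite mulrDl mul1r -[leLHS]addr0.
have N0 : 0 <= bform 1%:M x x.
  by rewrite bform1E; apply: sumr_ge0 => i _; exact: sqr_ge0.
apply: lerD => //.
rewrite bformE mulr_suml; apply: ler_sum => i _.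
rewrite mulr_suml; apply: ler_sum => j _.
apply: le_trans (ler_norm _) _; rewrite normrM ler_wpM2l//.
have hi k : x k 0 ^+ 2 <= bform 1%:M x x.
  rewrite bform1E (bigD1 k)//= lerDl; apply: sumr_ge0 => l _; exact: sqr_ge0.
move: (hi i) (hi j) (sqr_ge0 (x i 0 - x j 0)) (sqr_ge0 (x i 0 + x j 0)).
by rewrite ler_norml => *; apply/andP; split; lra.
Qed.

(** The squared length of [M *m x] is [bform M (M *m x) x]. Cauchy-Schwarz for [M] and boundedness
    of [M] estimate it, and one factor of the squared length cancels. *)
Lemma psd_image_le M : M^T = M -> (forall z, 0 <= bform M z z) ->
  exists2 C, 0 < C & forall x, bform 1%:M (M *m x) (M *m x) <= C * bform M x x.
Proof.
move=> Ms Mp; have [C C0 HC] := bform_bounded M; exists C => // x.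
have e : bform 1%:M (M *m x) (M *m x) = bform M (M *m x) x.
  by rewrite /bform mulmx1 !mulmxA.
have s0 : 0 <= bform 1%:M (M *m x) (M *m x).
  by rewrite bform1E; apply: sumr_ge0 => i _; exact: sqr_ge0.
have := bform_CauchySchwarz (M *m x) x Ms Mp; rewrite -e.
have := HC (M *m x); have := Mp x.
move: s0; rewrite le_eqVlt => /predU1P[<- h _ _|].
  by rewrite mulr_ge0// ltW.
set s := bform _ _ _; set t := bform M _ _; set u := bform M _ _.
move=> s0 u0 h1 h2.
rewrite -(ler_pM2l s0) -expr2; apply: le_trans h2 _.
by rewrite mulrA ler_wpM2r// mulrC.
Qed.

(** Since [x] is the image of [M *m x] under [invmx M], its length is controlled by that of
    [M *m x], which [psd_image_le] bounds. This replaces a spectral or compactness argument. *)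
Lemma psd_unitmx_coercive M : M^T = M -> (forall z, 0 <= bform M z z) ->
  M \in unitmx -> exists2 C, 0 < C & forall x, bform 1%:M x x <= C * bform M x x.
Proof.
move=> Ms Mp Mu; have [C C0 HC] := psd_image_le Ms Mp.
have [C' C'0 HC'] := bform_bounded ((invmx M)^T *m invmx M).
exists (C' * C); first exact: mulr_gt0.
move=> x; rewrite -mulrA.
apply: (@le_trans _ _ (C' * bform 1%:M (M *m x) (M *m x))); last first.
  by rewrite ler_wpM2l// ltW.
have := HC' (M *m x).
rewrite {1}/bform trmx_mul Ms -!mulmxA (mulmxA (invmx M) M) mulVmx// mul1mx.
by rewrite trmx_inv Ms (mulmxA M (invmx M)) mulmxV // /bform mul1mx !mulmx1.
Qed.

(* The supremum [S] of the Rayleigh quotient is an eigenvalue: [S D - A] is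
   positive semidefinite, and if it were invertible it would be coercive, so
   [S] could be lowered. *)
Lemma rayleigh_le A D e x : A^T = A -> D^T = D -> posdef D ->
  lmax_le (invmx D *m A) e -> bform A x x <= e * bform D x x.
Proof.
move=> As Ds Dp He.
have [->|x0] := eqVneq x 0; first by rewrite !bform0l mulr0.
have Du := posdef_unitmx Dp.
have [C1 C10 H1] := bform_bounded A.
have [C2 C20 H2] := psd_unitmx_coercive Ds (fun z => posdef_ge0 z Dp) Du.
have [C3 C30 H3] := bform_bounded D.
pose Q := [set bform A y y / bform D y y | y in [set y | y != 0]].
have Qub : has_ubound Q.
  exists (C1 * C2) => _ [y /= y0 <-].
  rewrite ler_pdivrMr ?Dp// -mulrA; apply: le_trans (H1 y) _.
  by rewrite ler_wpM2l// ltW.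
have QS y : y != 0 -> bform A y y <= sup Q * bform D y y.
  move=> y0; rewrite -ler_pdivrMr ?Dp//; apply: ub_le_sup => //.
  by exists y.
pose M := sup Q *: D - A.
have ME y : bform M y y = sup Q * bform D y y - bform A y y.
  by rewrite bformBm bformZm.
have Mp y : 0 <= bform M y y.
  have [->|y0] := eqVneq y 0; first by rewrite bform0l.
  by rewrite ME subr_ge0 QS.
have Ms : M^T = M by rewrite linearB linearZ /= As Ds.
suff Qe : sup Q <= e.
  by apply: le_trans (QS x x0) _; rewrite ler_wpM2r// posdef_ge0.
have : M \notin unitmx.
  apply/negP => Mu; have [C C0 HC] := psd_unitmx_coercive Ms Mp Mu.
  (* Coercivity gives [bform D y y <= C3 * C * bform M y y], so every quotient lies below [sup Q] by
     at least [(C3 * C)^-1]. *)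
  have : sup Q <= sup Q - (C3 * C)^-1.
    apply: ge_sup; first by exists (bform A x x / bform D x x), x.
    move=> _ [y /= y0 <-]; rewrite ler_pdivrMr ?Dp// mulrBl lerBrDr -lerBrDl.
    rewrite -ME mulrC ler_pdivrMr ?mulr_gt0//.
    apply: le_trans (H3 y) _.
    rewrite (_ : bform M y y * (C3 * C) = C3 * (C * bform M y y)); last by ring.
    by rewrite ler_wpM2l ?(ltW C30)//.
  by rewrite lerDl oppr_ge0 leNgt invr_gt0 mulr_gt0.
rewrite unitmxE unitfE negbK => /det0P[v v0 vM].
(* Eigenvectors are row vectors here: [v *m (sup Q *: D - A) = 0] makes [v *m D] a left eigenvector
   of [invmx D *m A]. *)
apply: He; apply/eigenvalueP; exists (v *m D).
  rewrite mulmxA -(mulmxA v) mulmxV// mulmx1.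
  by move/eqP: vM; rewrite mulmxBr subr_eq0 -scalemxAr => /eqP.
apply: contra_neq v0 => vD.
by rewrite -[v]mulmx1 -(mulmxV Du) mulmxA vD mul0mx.
Qed.

(** The row sums act as a potential and the entries [- S i j] as edge weights. The factor [2^-1] is
    there because each edge occurs in both orientations. *)
Lemma bform_graph S x : S^T = S -> bform S x x =
  \sum_i (\sum_j S i j) * x i 0 ^+ 2 - 2^-1 * \sum_i \sum_j S i j * (x i 0 - x j 0) ^+ 2.
Proof.
move=> Ss; have SE i j : S i j = S j i by rewrite -[in LHS]Ss mxE.
have E : \sum_i \sum_j S i j * x j 0 ^+ 2 = \sum_i (\sum_j S i j) * x i 0 ^+ 2.
  rewrite exchange_big; apply: eq_bigr => i _; rewrite mulr_suml.
  by apply: eq_bigr => j _; rewrite SE.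
have -> : \sum_i \sum_j S i j * (x i 0 - x j 0) ^+ 2 =
   \sum_i (\sum_j S i j) * x i 0 ^+ 2 + \sum_i \sum_j S i j * x j 0 ^+ 2
   - 2 * bform S x x.
  rewrite bformE mulr_sumr -!big_split -sumrB; apply: eq_bigr => i _ /=.
  rewrite mulr_suml mulr_sumr -big_split -sumrB; apply: eq_bigr => j _ /=; ring.
by rewrite E; field.
Qed.

Lemma bform_invmx D z : D^T = D -> D \in unitmx ->
  bform D (invmx D *m z) (invmx D *m z) = bform (invmx D) z z.
Proof.
move=> Ds Du; rewrite /bform trmx_mul trmx_inv Ds -!mulmxA.
by rewrite (mulmxA D) mulmxV// mul1mx.
Qed.

Lemma bform_invmx_apply D A v : D^T = D -> A^T = A ->
  bform A (invmx D *m (A *m v)) v = bform (invmx D) (A *m v) (A *m v).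
Proof. by move=> Ds As; rewrite /bform trmx_mul trmx_inv Ds -!mulmxA. Qed.

(** Put [u = invmx D *m A *m v] and let [G] be its squared [D]-norm. Expanding gives [- 2 * w * G]
    plus [w ^ 2] times the squared [A]-norm of [u], and the latter norm is at most [eta0 * G] by the
    Rayleigh bound. *)
Lemma bform_smoothing A D eta0 w eta v : A^T = A -> D^T = D -> posdef D ->
  lmax_le (invmx D *m A) eta0 -> eta <= w * (2 - w * eta0) ->
  let Kv := (1%:M - w *: (invmx D *m A)) *m v in
  bform A Kv Kv <= bform A v v - eta * bform (invmx D) (A *m v) (A *m v).
Proof.
move=> As Ds Dp He Heta /=.
have Du := posdef_unitmx Dp.
set u := invmx D *m (A *m v).
have -> : (1%:M - w *: (invmx D *m A)) *m v = v + (- w) *: u.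
  by rewrite mulmxBl mul1mx -scalemxAl -mulmxA scaleNr.
have := rayleigh_le u As Ds Dp He.
have := posdef_ge0 u Dp.
rewrite bform_invmx// bformDl !bformDr !bformZl !bformZr (bform_sym v u As).
rewrite bform_invmx_apply//.
set G := bform (invmx D) _ _ => G0 hu.
have := ler_wpM2l (sqr_ge0 w) hu; have := ler_wpM2r G0 Heta.
lra.
Qed.

End Fixed.

(** * The abstract two-grid estimate *)

Section TwoGrid.
Variables (n m : nat) (A D : 'M[R]_n) (P : 'M[R]_(n, m)) (Q : 'M[R]_(m, n)).
Hypotheses (As : A^T = A) (Ap : posdef A) (Ds : D^T = D) (Dp : posdef D).
Hypothesis PE : P = 2 *: Q^T.
Hypothesis P_inj : forall mu : 'cV_m, P *m mu = 0 -> mu = 0.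
Variable beta : R.
Hypothesis beta_gt0 : 0 < beta.
Hypothesis approx : forall x : 'cV_n, exists mu : 'cV_m,
  bform D (x - P *m mu) (x - P *m mu) <= beta * bform A x x.

Let C := Q *m A *m P.
Let T := 1%:M - P *m invmx C *m Q *m A.

(** Because [P = 2 *: Q^T], the form of [C] is half the form of [A] pulled back along the injective
    [P], hence definite. *)
Lemma coarse_unitmx : C \in unitmx.
Proof.
apply: posdef_unitmx => mu mu0.
have h : P *m mu != 0 by apply: contra_neq mu0; exact: P_inj.
have := Ap h.
suff -> : bform A (P *m mu) (P *m mu) = 2 * bform C mu mu by rewrite pmulr_rgt0.
rewrite -bformZm /bform trmx_mul {1}PE linearZ /= trmxK /C.
by rewrite -!mulmxA -!scalemxAl -!scalemxAr !mulmxA.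
Qed.

Lemma galerkin_orthogonal v mu : bform A (P *m mu) (T *m v) = 0.
Proof.
have QT : Q *m A *m T = 0.
  rewrite mulmxBr mulmx1 !mulmxA -/C mulmxV ?coarse_unitmx// mul1mx.
  by rewrite subrr.
rewrite /bform trmx_mul {1}PE linearZ /= trmxK.
rewrite -scalemxAr -!scalemxAl.
have -> : mu^T *m Q *m A *m (T *m v) = mu^T *m (Q *m A *m T *m v) by rewrite !mulmxA.
by rewrite QT mul0mx mulmx0 scaler0 mxE.
Qed.

(** [T] is the [A]-orthogonal projection along the range of [P], so this is Pythagoras. *)
Lemma coarse_correction_le v : bform A (T *m v) (T *m v) <= bform A v v.
Proof.
pose mu := invmx C *m Q *m A *m v.
have vE : v = T *m v + P *m mu.
  by rewrite mulmxBl mul1mx /mu !mulmxA subrK.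
rewrite {3 4}vE bformDl !bformDr galerkin_orthogonal.
rewrite (bform_sym (T *m v) (P *m mu) As) galerkin_orthogonal !add0r addr0.
by rewrite lerDl posdef_ge0.
Qed.

(** By orthogonality the squared [A]-norm of [e] is the pairing of [A *m e] with [e - P *m mu].
    Cauchy-Schwarz in the [D]-norm and the approximation property bound its square, and one factor
    [bform A e e] cancels. *)
Lemma coarse_correction_residual v (e := T *m v) :
  bform A e e <= beta * bform (invmx D) (A *m e) (A *m e).
Proof.
have Du := posdef_unitmx Dp.
have [mu Hmu] := approx e.
set z := e - P *m mu in Hmu.
have zE : bform A e e = bform D z (invmx D *m (A *m e)).
  have -> : bform A e e = bform A z e.
    by rewrite /z -scaleN1r bformDl bformZl galerkin_orthogonal mulr0 addr0.
  by rewrite /bform -[in RHS](mulmxA _ D) (mulmxA D) mulmxV// mul1mx mulmxA.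
have := bform_CauchySchwarz z (invmx D *m (A *m e)) Ds (fun y => posdef_ge0 y Dp).
rewrite -zE bform_invmx//.
have G0 := posdef_ge0 (invmx D *m (A *m e)) Dp; rewrite bform_invmx// in G0.
have := posdef_ge0 e Ap; rewrite le_eqVlt => /predU1P[<- _|E0 h].
  by rewrite mulr_ge0// ltW.
rewrite -(ler_pM2l E0) -expr2; apply: le_trans h _.
by apply: le_trans (ler_wpM2r G0 Hmu) _; rewrite mulrCA mulrA.
Qed.

(** The maximum with [0] keeps the factor nonnegative, so that the contraction by [T] can be applied
    after the smoothing estimate. *)
Lemma two_grid_le K eta v : 0 <= eta ->
  (forall x : 'cV_n, bform A (K *m x) (K *m x)
     <= bform A x x - eta * bform (invmx D) (A *m x) (A *m x)) ->
  bform A (K *m T *m v) (K *m T *m v) <= Num.max 0 (1 - eta / beta) * bform A v v.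
Proof.
move=> eta0 HK; rewrite -mulmxA; set e := T *m v.
have h1 : bform A (K *m e) (K *m e) <= (1 - eta / beta) * bform A e e.
  apply: le_trans (HK e) _; rewrite mulrBl mul1r lerB// -mulrA ler_wpM2l//.
  by rewrite ler_pdivrMl//; exact: coarse_correction_residual.
apply: le_trans h1 _.
apply: (@le_trans _ _ (Num.max 0 (1 - eta / beta) * bform A e e)).
  by rewrite ler_wpM2r ?posdef_ge0// le_max lexx orbT.
by rewrite ler_wpM2l ?le_max ?lexx//; exact: coarse_correction_le.
Qed.
End TwoGrid.
End BilinearForms.

(** * The entries of B_h *)

Section Entries.
Variable R : realType.
Variables a p : R.
Hypotheses (pE : p = 3 - a) (p12 : 1 < p < 2).

Let f (k : nat) : R := pw k p.
Let f1 (k : nat) : R := p * pw k (p - 1).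

(** One-sided boundary corrections: [bt_diag] at [i] is [e_diag i + e_diag (N - i)], and [bt_off] at
    [i] is [e_off i + e_off (N - i.+1)]. *)
Let e_diag (k : nat) : R := 2 * (f k.+1 - 2 * f1 k - f k.-1).
Let e_off (k : nat) : R := - 2 * (f k.+1 - f k) + f1 k.+1 + f1 k.

(** The values at [0] and [1] are the same negated fourth difference of [|x| ^ p], with arguments
    reflected at the origin. *)
Let toep (m : nat) : R := if m == 0%N then 8 - 2 * 2 `^ p
  else if m == 1%N then - 7 - 3 `^ p + 4 * 2 `^ p
  else - f m.+2 + 4 * f m.+1 - 6 * f m + 4 * f m.-1 - f (m - 2).

Let pow2S : 2 `^ (4 - a) = 2 * 2 `^ p.
Proof.
rewrite (_ : 4 - a = 1 + p); last by rewrite pE; ring.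
by rewrite powRD ?pnatr_eq0 ?implybT// powRr1.
Qed.

Let pow2SS : 2 `^ (5 - a) = 4 * 2 `^ p.
Proof.
rewrite (_ : 5 - a = 1 + (4 - a)); last by ring.
rewrite powRD ?pnatr_eq0 ?implybT// powRr1// pow2S; ring.
Qed.

Let pB1 : 2 - a = p - 1. Proof. by rewrite pE; ring. Qed.

Let b_entry_diag N i : b_entry a N i i = toep 0%N + e_diag i + e_diag (N - i).
Proof.
rewrite /b_entry leqnn subnn /= /bt_diag pow2S pB1 subn1 /e_diag /f1 -pE /toep /= /f; ring.
Qed.

Let b_entry_next N i : (i < N)%N ->
  b_entry a N i i.+1 = toep 1%N + e_off i + e_off (N - i.+1).
Proof.
move=> iN; rewrite /b_entry leqnSn subSnn /= /bt_off pow2SS pB1.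
rewrite /e_off /f1 -pE /toep /= /f (minn_idPl _)//.
have -> : (N - i = (N - i.+1).+1)%N by lia.
by rewrite subn1 /=; ring.
Qed.

Let b_entry_far N i m : (2 <= m)%N -> b_entry a N i (i + m) = toep m.
Proof.
move=> m2; rewrite /b_entry leq_addr addKn /toep /f -pE.
by case: m m2 => [|[|m]].
Qed.

Lemma b_entry_sym N i j : b_entry a N i j = b_entry a N j i.
Proof.
by rewrite /b_entry minnC; case: (ltngtP i j) => [ij|ij|->] //;
  rewrite subn_eq0 leqNgt ij.
Qed.

Let e_off_le0 k : (1 <= k)%N -> e_off k <= 0.
Proof. by move=> /(pw_trapezoid_le p12); rewrite /e_off /f /f1; lra. Qed.

Let e_diag_le0 k : (1 <= k)%N -> e_diag k <= 0.
Proof. by move=> /(pw_central_difference_le p12); rewrite /e_diag /f /f1; lra. Qed.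

Let toep_far_lt0 m : (2 <= m)%N -> toep m < 0.
Proof.
move=> m2; have := pw_fourth_difference_gt0 p12 m2.
by rewrite /toep; case: m m2 => [|[|m]] // _ /=; rewrite /f; lra.
Qed.

Let pow2_lt4 : 2 `^ p < 4 :> R.
Proof.
have -> : 4 = 2 `^ 2 :> R by rewrite -[X in _ `^ X]/(2%:R) powR_mulrn//; ring.
by rewrite /powR pnatr_eq0 /= ltr_expR ltr_pM2r ?ln_gt0 ?ltr1n//; case/andP: p12.
Qed.

Let toep0_gt0 : 0 < toep 0%N.
Proof. by rewrite /toep /=; have := pow2_lt4; lra. Qed.

(** The constant 5 enters here: spelled out, this is the inequality [powR2_powR3_le]. *)
Let toep0_le : toep 0%N <= 5 * - toep 1%N.
Proof. by rewrite /toep /=; have := powR2_powR3_le p12; lra. Qed.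

Let b_entry_diag_le N i : (1 <= i < N)%N -> b_entry a N i i <= toep 0%N.
Proof.
move=> /andP[i1 iN]; rewrite b_entry_diag.
have := e_diag_le0 i1; have : e_diag (N - i) <= 0 by apply: e_diag_le0; rewrite subn_gt0.
lra.
Qed.

Let e_diag1 : toep 0%N + e_diag 1%N = 8 - 4 * p.
Proof.
rewrite /toep /e_diag /f /f1 /pw /= !powR1 powR0; first by ring.
by rewrite gt_eqF//; case/andP: p12; lra.
Qed.

Let b_entry_next_le N i : (1 <= i)%N -> (i.+1 < N)%N ->
  b_entry a N i i.+1 <= - (toep 0%N / 5).
Proof.
move=> i1 iN; rewrite b_entry_next; last exact: ltnW.
have := e_off_le0 i1; have : e_off (N - i.+1) <= 0 by apply: e_off_le0; rewrite subn_gt0.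
have := toep0_le; lra.
Qed.

Lemma b_entry_off_le0 N i j : (1 <= i < N)%N -> (1 <= j < N)%N -> i != j ->
  b_entry a N i j <= 0.
Proof.
wlog ij : i j / (i < j)%N.
  move=> H iN jN ij; case: (ltngtP i j) => [h|h|h]; first exact: H.
  - by rewrite b_entry_sym; apply: H => //; rewrite eq_sym.
  - by rewrite h eqxx in ij.
move=> /andP[i1 iN] /andP[j1 jN] _.
have [jE|/eqP jE] := eqVneq j i.+1.
  rewrite jE in jN *; apply: le_trans (b_entry_next_le i1 jN) _.
  by have := toep0_gt0; lra.
rewrite -(subnKC (ltnW ij)) b_entry_far; last by lia.
by apply/ltW/toep_far_lt0; lia.
Qed.

Let third (k : nat) : R := f k.+1 - 3 * f k + 3 * f k.-1 - f (k - 2).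

(** Each fourth difference is an increment of [third], so the sum telescopes. The number [c] stands
    for the boundary correction of the adjacent entry, the only corrected one on this side of the
    diagonal. *)
Let half_row (c : R) K : (1 <= K)%N ->
  \sum_(1 <= m < K) (toep m + (if m == 1%N then c else 0)) =
  if K == 1%N then 0 else 2 `^ p - 4 - third K + c.
Proof.
case: K => // K _; elim: K => [|K IH]; first by rewrite big_geq.
rewrite big_nat_recr//= {}IH.
case: K => [|K].
  rewrite /= /toep /third /f /pw /= powR1 powR0; first by ring.
  by rewrite gt_eqF//; case/andP: p12; lra.
rewrite /= addr0 /toep /= /third !subSS !subn0 /=; ring.
Qed.

Let sum_left N i : (1 <= i < N)%N ->
  \sum_(1 <= j < i) b_entry a N i j =
  if i == 1%N then 0 else 2 `^ p - 4 - third i + (e_off i.-1 + e_off (N - i)).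
Proof.
move=> /andP[i1 iN]; rewrite -half_row// big_nat_rev /=.
rewrite big_nat [RHS]big_nat; apply: eq_bigr => j /andP[j1 ji].
rewrite add1n subSS b_entry_sym.
have [->|/eqP j1'] := eqVneq j 1%N.
  case: i i1 iN ji => [//|i] _ iN ji.
  by rewrite subn1 /= b_entry_next ?addrA//; lia.
rewrite (_ : b_entry a N (i - j) i = b_entry a N (i - j) (i - j + j)); last by rewrite subnK// ltnW.
by rewrite b_entry_far ?addr0//; lia.
Qed.

Let sum_right N i : (1 <= i < N)%N ->
  \sum_(i.+1 <= j < N) b_entry a N i j =
  if (N - i == 1)%N then 0
  else 2 `^ p - 4 - third (N - i) + (e_off i + e_off (N - i).-1).
Proof.
move=> /andP[i1 iN]; rewrite -half_row ?subn_gt0//.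
rewrite -{1}(add1n i) -{1}(subnK (ltnW iN)) big_addn addnK.
rewrite big_nat [RHS]big_nat; apply: eq_bigr => m /andP[m1 mN].
rewrite addnC.
have [->|/eqP m1'] := eqVneq m 1%N.
  rewrite addn1 b_entry_next//; have -> : (N - i.+1 = (N - i).-1)%N by lia.
  by rewrite [RHS]addrA.
by rewrite b_entry_far ?addr0//; lia.
Qed.

(* [B_h] is the Toeplitz matrix of [- delta^4 |x| ^ p] plus a tridiagonal correction
   whose [i]-th entries are a function of [i] plus the same function of [N - i]; the
   row sum telescopes into two mirror images of [half]. *)
Let half (k : nat) : R := if k == 1%N then 4 - 2 `^ p + e_diag 1%N + e_off 1%N
  else - third k + e_diag k + e_off k.-1 + e_off k.

(** Interior rows give equality. In the first and last rows one neighbour is missing, and [half]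
    still contains its [e_off] term, which is nonpositive. *)
Let row_sum_ge N i : (3 <= N)%N -> (1 <= i < N)%N ->
  half i + half (N - i) <= \sum_(1 <= j < N) b_entry a N i j.
Proof.
move=> N3 iN'; have /andP[i1 iN] := iN'.
rewrite (big_cat_nat _ (n := i))//=; last exact: ltnW.
rewrite (big_ltn iN) sum_left// sum_right// b_entry_diag.
rewrite {1}/toep /= /half.
have h1 := e_off_le0 i1.
have h2 : e_off (N - i) <= 0 by apply: e_off_le0; rewrite subn_gt0.
have [i1'|i1'] := eqVneq i 1%N; have [Ni|Ni] := eqVneq (N - i)%N 1%N.
- lia.
- by rewrite i1' in h1 h2 *; lra.
- by rewrite Ni in h1 h2 *; lra.
- lra.
Qed.

Let half1 : half 1%N >= (8 - 4 * p) / 5.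
Proof.
have /andP[p1 p2] := p12.
rewrite /half /= /e_diag /e_off /f /f1 /pw /= !powR1 powR0; last by rewrite gt_eqF//; lra.
have -> : 2 `^ (p - 1) = 2 `^ p / 2 :> R.
  by rewrite powRB ?pnatr_eq0 ?implybT// powRr1.
(* [half 1] factors as [2 - p] times [3 - 2 ^ p / 2], so its excess over the claimed bound is one
   fifth of this product. *)
have : 0 <= (2 - p) * (11 - 5 / 2 * 2 `^ p) by apply: mulr_ge0; have := pow2_lt4; lra.
lra.
Qed.

(** For [k >= 2] all values of [f] in the corrections cancel, leaving the second difference of [f1]
    minus [third k], positive by [pw_third_difference_lt]. *)
Let half_gt0 k : (1 <= k)%N -> 0 < half k.
Proof.
move=> k1; have [->|/eqP kn1] := eqVneq k 1%N.
  by apply: lt_le_trans half1; have /andP[p1 p2] := p12; lra.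
have k2 : (2 <= k)%N by lia.
have := pw_third_difference_lt p12 k2.
rewrite /half (negPf (introN eqP kn1)) /third /e_diag /e_off /f /f1.
case: k k1 kn1 k2 => // k _ _ _ /=; lra.
Qed.

Lemma b_entry_row_sum_gt0 N i : (3 <= N)%N -> (1 <= i < N)%N ->
  0 < \sum_(1 <= j < N) b_entry a N i j.
Proof.
move=> N3 iN; apply: lt_le_trans (row_sum_ge N3 iN); case/andP: iN => i1 iN.
by apply: addr_gt0; apply: half_gt0; rewrite // subn_gt0.
Qed.

(** A boundary diagonal entry is at most [toep 0 + e_diag 1 = 8 - 4 * p], while [half 1] alone
    already contributes a fifth of that to the row sum. *)
Lemma b_entry_row_sum_boundary N i : (3 <= N)%N -> (i == 1)%N || (i == N.-1)%N ->
  b_entry a N i i / 5 <= \sum_(1 <= j < N) b_entry a N i j.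
Proof.
move=> N3 ib; have iN : (1 <= i < N)%N by lia.
apply: le_trans (row_sum_ge N3 iN).
rewrite b_entry_diag; case/andP: iN => i1 iN.
have := half_gt0 i1; have := e_diag_le0 i1.
have Ni : (1 <= N - i)%N by rewrite subn_gt0.
have := half_gt0 Ni; have := e_diag_le0 Ni; have := half1; have := e_diag1.
case/orP: ib => [/eqP ->|/eqP iE]; first by lra.
have -> : (N - i = 1)%N by lia.
lra.
Qed.

Lemma b_entry_adjacent_le N i j : (1 <= i < N)%N -> (1 <= j < N)%N ->
  (j == i.+1) || (i == j.+1) -> b_entry a N i j <= - (b_entry a N i i / 5).
Proof.
move=> iN jN ij.
apply: (@le_trans _ _ (- (toep 0%N / 5))); last first.
  by have := b_entry_diag_le iN; lra.
case/orP: ij => /eqP E.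
  by rewrite E; apply: b_entry_next_le; lia.
by rewrite b_entry_sym E; apply: b_entry_next_le; lia.
Qed.
End Entries.

(** * The approximation property *)

Section GraphEnergy.
Variables (R : realType) (n : nat) (S : 'M[R]_n).
Hypotheses (Ss : S^T = S) (S_off : forall i j, i != j -> S i j <= 0).
Hypothesis S_row : forall i, 0 < \sum_j S i j.

(** In the graph decomposition only the potential on [O] and the edges leaving [O] are kept;
    everything dropped is nonnegative. *)
Lemma bform_bipartite (O : pred 'I_n) (x : 'cV[R]_n) :
  \sum_(i | O i) ((\sum_j S i j) * x i 0 ^+ 2
     + \sum_(j | ~~ O j) - S i j * (x i 0 - x j 0) ^+ 2) <= bform S x x.
Proof.
pose g i j := - S i j * (x i 0 - x j 0) ^+ 2.
have g0 i j : 0 <= g i j.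
  rewrite /g; have [->|ij] := eqVneq i j; first by rewrite subrr expr0n mulr0.
  by rewrite mulr_ge0 ?sqr_ge0// oppr_ge0 S_off.
have gs i j : g i j = g j i by rewrite /g -[in LHS]Ss mxE; ring.
rewrite bform_graph// big_split /=; apply: lerD.
  rewrite [leRHS](bigID O)/= lerDl; apply: sumr_ge0 => i _.
  by rewrite mulr_ge0 ?sqr_ge0// ltW.
rewrite -mulrN -sumrN.
under [X in _ * X]eq_bigr => i _ do rewrite -sumrN.
have -> : \sum_i \sum_j - (S i j * (x i 0 - x j 0) ^+ 2) = \sum_i \sum_j g i j.
  by apply: eq_bigr => i _; apply: eq_bigr => j _; rewrite /g mulNr.
have -> : \sum_(i | O i) \sum_(j | ~~ O j) - S i j * (x i 0 - x j 0) ^+ 2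
  = \sum_(i | O i) \sum_(j | ~~ O j) g i j by [].
(* The full double sum contains each edge leaving [O] twice, from either endpoint, which compensates
   the factor [2^-1]. *)
set E := \sum_(i | _) _.
have E1 : E <= \sum_(i | O i) \sum_j g i j.
  apply: ler_sum => i _; rewrite [leRHS](bigID O)/= lerDr; exact: sumr_ge0.
have E2 : E <= \sum_(i | ~~ O i) \sum_j g i j.
  rewrite /E exchange_big; apply: ler_sum => i _; rewrite [leRHS](bigID O)/=.
  under eq_bigr => j _ do rewrite gs.
  rewrite lerDl; exact: sumr_ge0.
rewrite [X in _ * X](bigID O)/=; lra.
Qed.

Lemma M_matrix_posdef : posdef S.
Proof.
move=> x x0.
have [i xi] : exists i, x i 0 != 0.
  apply/existsP; apply: contraR x0 => /existsPn H; apply/eqP/colP => i.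
  by rewrite mxE; apply/eqP; move: (H i); rewrite negbK.
apply: lt_le_trans (bform_bipartite predT x).
(* With [O] the whole index set the edge sums are empty and only the positive potential remains. *)
rewrite (bigD1 i)//= big_pred0_eq addr0.
apply: ltr_wpDr; last by rewrite mulr_gt0// exprn_even_gt0.
apply: sumr_ge0 => j _; rewrite big_pred0_eq addr0.
by rewrite mulr_ge0 ?sqr_ge0// ltW.
Qed.
End GraphEnergy.

Section Prolongation.
Variable R : realType.
Variables (q : nat).
Hypothesis q2 : (2 <= q)%N.
Local Notation n := (2 ^ q).-1.
Local Notation m := (2 ^ q %/ 2).-1.

Lemma grid_size : n = (2 * m).+1 /\ (0 < m)%N.
Proof.
case: q q2 => [|[|k]] // _.
rewrite expnS mulKn//; have : (0 < 2 ^ k)%N by rewrite expn_gt0.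
rewrite expnS; lia.
Qed.

Lemma sum_ord_delta (V : nmodType) (k l : nat) (F : nat -> V) :
  \sum_(i < k) (if i == l :> nat then F i else 0) = if (l < k)%N then F l else 0.
Proof.
rewrite -big_mkcond /=; case: ltnP => lk; first exact: (big_pred1 (Ordinal lk)).
rewrite big_pred0 // => i; apply/negbTE; rewrite neq_ltn.
by rewrite (leq_trans (ltn_ord i) lk).
Qed.

(** Extension by the boundary value [0] beyond the last grid point. *)
Let X (x : 'cV[R]_n) (j : nat) : R := if insub j is Some i then x i 0 else 0.

Let X_ord x (i : 'I_n) : X x i = x i 0. Proof. by rewrite /X valK. Qed.

Let X_out x j : (n <= j)%N -> X x j = 0.
Proof. by move=> h; rewrite /X insubF// ltnNge h. Qed.

Lemma prol_odd (mu : 'cV[R]_m) (k : 'I_m) (i : 'I_n) : i = (2 * k).+1 :> nat ->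
  (prol R q *m mu) i 0 = mu k 0.
Proof.
move=> ik; rewrite mxE (bigD1 k)//= big1 ?addr0.
  rewrite !mxE ik ifF; last by lia.
  by rewrite eqxx; field.
move=> l lk; rewrite !mxE ik.
have {}lk : (l : nat) != k by rewrite (inj_eq val_inj).
rewrite ifF; last by lia.
rewrite ifF; last by move/eqP: lk; lia.
rewrite ifF; last by lia.
by rewrite mulr0 mul0r.
Qed.

Lemma prol_inj (mu : 'cV[R]_m) : prol R q *m mu = 0 -> mu = 0.
Proof.
move=> H; apply/colP => k; have [nE m0] := grid_size.
have kn : ((2 * k).+1 < n)%N by have := ltn_ord k; rewrite nE; lia.
by rewrite -(@prol_odd mu k (Ordinal kn))// H !mxE.
Qed.

(* Indices are 0-based, so the coarse points are the odd ones. *)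
Let mu_of x : 'cV[R]_m := \col_k X x (2 * k).+1.

Let prol_even x (i : 'I_n) : ~~ odd i ->
  (prol R q *m mu_of x) i 0 =
  2^-1 * (X x i.+1 + (if i == 0%N :> nat then 0 else X x i.-1)).
Proof.
move=> io; have [nE m0] := grid_size.
have [l il] : exists l, i = (2 * l)%N :> nat by exists (i./2); lia.
rewrite mxE.
(* Row [2 * l] meets only the columns [l] and [l.-1]. The inner test removes the second one when
   [l = 0], where [l.-1] would again be [0]. *)
transitivity (2^-1 * (\sum_(k < m) (if k == l :> nat then X x (2 * k).+1 else 0)
  + \sum_(k < m) (if k == l.-1 :> nat then (if l == 0%N then 0 else X x (2 * k).+1) else 0))).
  rewrite -big_split mulr_sumr; apply: eq_bigr => k _; rewrite !mxE il /=.
  have [->|kl] := eqVneq (nat_of_ord k) l.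
    rewrite eqxx; have [->|l0] := eqVneq l 0%N; first by rewrite /= addr0; field.
    by rewrite ifF; [field|lia].
  rewrite ifF; last by lia.
  rewrite ifF; last by lia.
  have [l0|l0] := eqVneq l 0%N.
    by rewrite ifF; [rewrite if_same; field|lia].
  have [kl'|kl'] := eqVneq (nat_of_ord k) l.-1.
    by rewrite ifT; [field|lia].
  by rewrite ifF; [field|lia].
rewrite !(sum_ord_delta m _ (fun k => X x (2 * k).+1)).
rewrite (sum_ord_delta m _ (fun k => if l == 0%N then 0 else X x (2 * k).+1)).
have li := ltn_ord i; rewrite il nE in li.
congr (_ * (_ + _)).
  rewrite il; case: ltnP => lm //; rewrite X_out// nE; lia.
rewrite ifT; last by lia.
rewrite il muln_eq0 /=; have [//|l0] := eqVneq l 0%N.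
by congr (X x _); lia.
Qed.

Variable S : 'M[R]_n.
Hypotheses (Ss : S^T = S) (S_off : forall i j, i != j -> S i j <= 0).
Hypothesis S_row : forall i, 0 < \sum_j S i j.
Hypothesis S_diag : forall i, 0 <= S i i.
Hypothesis S_adj : forall i j : 'I_n, (j == i.+1 :> nat) || (i == j.+1 :> nat) ->
  S i j <= - (S i i / 5).
Hypothesis S_boundary : forall i : 'I_n, (i == 0%N :> nat) || (i == n.-1 :> nat) ->
  S i i / 5 <= \sum_j S i j.

(** The error vanishes at coarse points. At a fine point with neighbour values [u] and [v],
    convexity of the square gives the factor [1 / 2], and bounding the diagonal by five times an
    edge weight or boundary row sum gives the factor 5. *)
Lemma prol_approximation (x : 'cV[R]_n) : exists mu : 'cV[R]_m,
  bform (diagpart S) (x - prol R q *m mu) (x - prol R q *m mu) <= 5 / 2 * bform S x x.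
Proof.
exists (mu_of x); set z := x - _.
have [nE m0] := grid_size.
have zE i : z i 0 = x i 0 - (prol R q *m mu_of x) i 0 by rewrite /z !mxE.
have -> : bform (diagpart S) z z = \sum_i S i i * z i 0 ^+ 2.
  rewrite bformE; apply: eq_bigr => i _; rewrite (bigD1 i)//= big1 ?addr0.
    by rewrite !mxE eqxx mulr1n expr2.
  by move=> j ji; rewrite !mxE eq_sym (negPf ji) mulr0n mul0r.
rewrite (bigID (fun i : 'I_n => ~~ odd i)) /= [X in _ + X]big1 ?addr0; last first.
  move=> i; rewrite negbK => io.
  have im : (i./2 < m)%N by have := ltn_ord i; rewrite {2}nE; lia.
  rewrite zE (@prol_odd _ (Ordinal im)) /=; last by lia.
  rewrite mxE /= (_ : (2 * i./2).+1 = i); last by lia.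
  by rewrite X_ord subrr expr0n mulr0.
apply: (@le_trans _ _ (5 / 2 * \sum_(i : 'I_n | ~~ odd i) ((\sum_j S i j) * x i 0 ^+ 2
     + \sum_(j : 'I_n | ~~ ~~ odd j) - S i j * (x i 0 - x j 0) ^+ 2))); last first.
  apply: ler_wpM2l; first by lra.
  exact: (bform_bipartite Ss S_off S_row (fun i : 'I_n => ~~ odd i)).
rewrite mulr_sumr; apply: ler_sum => i io.
rewrite zE prol_even//.
set d := S i i; set r := \sum_j S i j; set y := x i 0.
have d0 : 0 <= d := S_diag i.
have r0 : 0 <= r * y ^+ 2 by rewrite mulr_ge0 ?sqr_ge0//; apply/ltW/S_row.
have g0 (j : 'I_n) : ~~ ~~ odd j -> 0 <= - S i j * (y - x j 0) ^+ 2.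
  move=> jo; rewrite mulr_ge0 ?sqr_ge0// oppr_ge0 S_off//.
  by apply: contraNneq jo => <-.
have gadj (j : 'I_n) : (j == i.+1 :> nat) || (i == j.+1 :> nat) ->
    d / 5 * (y - x j 0) ^+ 2 <= - S i j * (y - x j 0) ^+ 2.
  by move=> ij; rewrite ler_wpM2r ?sqr_ge0// lerNr S_adj.
have rb : (i == 0%N :> nat) || (i == n.-1 :> nat) -> d / 5 * y ^+ 2 <= r * y ^+ 2.
  by move=> ib; rewrite ler_wpM2r ?sqr_ge0// S_boundary.
(* The slack in the convexity estimate is [d / 4 * (u - v) ^ 2]. *)
have key u v : d / 5 * (y - u) ^+ 2 + d / 5 * (y - v) ^+ 2
     <= r * y ^+ 2 + \sum_(j : 'I_n | ~~ ~~ odd j) - S i j * (y - x j 0) ^+ 2 ->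
   d * (y - 2^-1 * (u + v)) ^+ 2 <= 5 / 2 * (r * y ^+ 2 +
      \sum_(j : 'I_n | ~~ ~~ odd j) - S i j * (y - x j 0) ^+ 2).
  move=> h; have := mulr_ge0 d0 (sqr_ge0 (u - v)); lra.
apply: key.
(* At either end of the grid the missing neighbour has value [0], and its term [d / 5 * y ^ 2] is
   charged to the row sum. *)
have [i0|i0] := eqVneq (nat_of_ord i) 0%N.
  have i1n : (i.+1 < n)%N by lia.
  rewrite (bigD1 (Ordinal i1n))/=; last by rewrite i0.
  rewrite (X_ord x (Ordinal i1n)) subr0 [leLHS]addrC; apply: lerD; first by rewrite rb ?i0.
  rewrite -[leLHS]addr0; apply: lerD; first by apply: gadj; rewrite eqxx.
  by apply: sumr_ge0 => j /andP[]; rewrite !negbK => jo _; apply: g0; rewrite negbK.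
have ipn : (i.-1 < n)%N by have := ltn_ord i; lia.
rewrite (bigD1 (Ordinal ipn))/=; last by lia.
rewrite (X_ord x (Ordinal ipn)).
have gp : d / 5 * (y - x (Ordinal ipn) 0) ^+ 2
    <= - S i (Ordinal ipn) * (y - x (Ordinal ipn) 0) ^+ 2.
  by apply: gadj => /=; lia.
have [il|il] := eqVneq (nat_of_ord i) n.-1.
  rewrite X_out ?subr0; last by lia.
  apply: lerD; first by rewrite rb ?il ?eqxx ?orbT.
  rewrite -[leLHS]addr0; apply: lerD => //.
  by apply: sumr_ge0 => j /andP[]; rewrite !negbK => jo _; apply: g0; rewrite negbK.
have i1n : (i.+1 < n)%N by have := ltn_ord i; lia.
rewrite (bigD1 (Ordinal i1n))/=; last first.
  by rewrite -val_eqE /=; lia.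
rewrite (X_ord x (Ordinal i1n)).
have gn : d / 5 * (y - x (Ordinal i1n) 0) ^+ 2
    <= - S i (Ordinal i1n) * (y - x (Ordinal i1n) 0) ^+ 2.
  by apply: gadj => /=; rewrite eqxx.
set rest := \sum_(j | _) _.
have : 0 <= rest.
  by apply: sumr_ge0 => j /andP[/andP[jo _] _]; exact: g0.
lra.
Qed.
End Prolongation.

(** * Definiteness and approximation property of B_h *)

Section SpectralEquivalence.
Variables (R : realType) (a : R) (q : nat).
Hypotheses (a1 : 1 < a) (a2 : a < 2) (q2 : (2 <= q)%N).
Local Notation S := (Bh a q).

Let N_ge4 : (4 <= 2 ^ q)%N.
Proof. by rewrite (@leq_exp2l 2 2 q). Qed.

Let p12 : 1 < 3 - a < 2. Proof. by move: a1 a2 => h1 h2; apply/andP; split; lra. Qed.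

Let index_bounds (i : 'I_(2 ^ q).-1) : (1 <= i.+1 < 2 ^ q)%N.
Proof. by have := ltn_ord i; rewrite -ltnS prednK ?expn_gt0. Qed.

Lemma Bh_sym : S^T = S.
Proof. by apply/matrixP => i j; rewrite !mxE b_entry_sym. Qed.

Lemma Bh_off_le0 i j : i != j -> S i j <= 0.
Proof.
move=> ij; rewrite mxE; apply: (b_entry_off_le0 (p := 3 - a)) => //.
Qed.

Let row_sumE i : \sum_j S i j = \sum_(1 <= j < 2 ^ q) b_entry a (2 ^ q) i.+1 j.
Proof. by rewrite big_add1 big_mkord; apply: eq_bigr => j _; rewrite mxE. Qed.

Lemma Bh_row_sum_gt0 i : 0 < \sum_j S i j.
Proof.
rewrite row_sumE; apply: (b_entry_row_sum_gt0 (p := 3 - a)) => //.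
by lia.
Qed.

Lemma Bh_diag_gt0 i : 0 < S i i.
Proof.
apply: lt_le_trans (Bh_row_sum_gt0 i) _; rewrite (bigD1 i)//= gerDl.
by apply: sumr_le0 => j ji; apply: Bh_off_le0; rewrite eq_sym.
Qed.

Lemma Bh_posdef : posdef S.
Proof. exact: M_matrix_posdef Bh_sym Bh_off_le0 Bh_row_sum_gt0. Qed.

Lemma diag_Bh_posdef : posdef (diagpart S).
Proof.
have off i j : i != j -> diagpart S i j = 0.
  by move=> ij; rewrite !mxE (negPf ij) mulr0n.
apply: M_matrix_posdef.
- by rewrite /diagpart tr_diag_mx.
- by move=> i j /off ->.
- move=> i; rewrite (bigD1 i)//= big1 ?addr0 => [|j ji].
    by rewrite mxE eqxx mulr1n mxE Bh_diag_gt0.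
  by rewrite off// eq_sym.
Qed.

Lemma Bh_approximation x : exists mu,
  bform (diagpart S) (x - prol R q *m mu) (x - prol R q *m mu) <= 5 / 2 * bform S x x.
Proof.
apply: prol_approximation => //.
- exact: Bh_sym.
- exact: Bh_off_le0.
- exact: Bh_row_sum_gt0.
- by move=> i; apply/ltW/Bh_diag_gt0.
- move=> i j ij; rewrite !mxE; apply: (b_entry_adjacent_le (p := 3 - a)) => //.
- move=> i ib; rewrite row_sumE mxE.
  by apply: (b_entry_row_sum_boundary (p := 3 - a)) => //; lia.
Qed.
End SpectralEquivalence.

(** * Scaling to A_q and the contraction bound *)

Lemma diagpartZ (R : realType) n (c : R) (M : 'M[R]_n) :
  diagpart (c *: M) = c *: diagpart M.
Proof. by apply/matrixP => i j; rewrite !mxE mulrnAr. Qed.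

(** A shift by [pi / 2] turns the cosine into minus a sine of an angle in [[0, pi]]. Nonnegativity
    of [Gamma] comes from its integrand; a zero coefficient is treated separately. *)
Lemma Aq_coef_ge0 (R : realType) (a h : R) : 1 < a < 2 ->
  0 <= kappa a / (h `^ (a - 1) * Gamma (4 - a)).
Proof.
move=> /andP[a1 a2]; have pi0 := pi_gt0 R.
apply: divr_ge0; last first.
  apply: mulr_ge0; first exact: powR_ge0.
  by apply: Rintegral_ge0 => t _; rewrite mulr_ge0 ?powR_ge0 ?expR_ge0.
rewrite /kappa mulN1r oppr_ge0 invr_le0.
have -> : a * pi / 2 = (a - 1) * (pi / 2) + pi / 2 by field.
rewrite cosDpihalf mulrN oppr_le0 mulr_ge0// sin_ge0_pi//; apply/andP; split.
  by apply: mulr_ge0; lra.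
nra.
Qed.

Lemma opnorm_le (R : realType) n (M X : 'M[R]_n) (C : R) : (0 < n)%N ->
  (forall v : 'cV[R]_n, v != 0 -> mnorm M (X *m v) / mnorm M v <= C) -> opnorm M X <= C.
Proof.
move=> n0 XC; apply: ge_sup => [|_ [v /= v0 <-]]; last exact: XC.
pose u : 'cV[R]_n := const_mx 1.
exists (mnorm M (X *m u) / mnorm M u), u => //=.
apply/negP => /eqP/colP/(_ (Ordinal n0)).
by rewrite !mxE; apply/eqP; rewrite oner_neq0.
Qed.

Lemma two_grid_convergence (R : realType) (a c : R) (q : nat) (eta0 w eta : R)
    (A := c *: Bh a q) :
  1 < a -> a < 2 -> (2 <= q)%N -> 0 < c ->
  lmax_le (invmx (diagpart A) *m A) eta0 ->
  0 < eta -> eta <= w * (2 - w * eta0) ->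
  (forall v : 'cV[R]_((2 ^ q).-1),
     mnorm A (jacobi w A *m v) ^+ 2
     <= mnorm A v ^+ 2 - eta * mnorm (invmx (diagpart A)) (A *m v) ^+ 2)
  /\ opnorm A (jacobi w A *m cgc A) <= Num.sqrt (1 - 2 * eta / 5).
Proof.
move=> a1 a2 q2 c0 He eta_gt0 Heta.
have As : A^T = A by rewrite linearZ /= Bh_sym.
have posdefZ n (M : 'M[R]_n) : posdef M -> posdef (c *: M).
  by move=> Mp x x0; rewrite bformZm mulr_gt0// Mp.
have Ap : posdef A := posdefZ _ _ (Bh_posdef a1 a2 q2).
have Dp : posdef (diagpart A).
  by rewrite diagpartZ; apply/posdefZ/diag_Bh_posdef.
have Ds : (diagpart A)^T = diagpart A by rewrite /diagpart tr_diag_mx.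
have iD0 z : 0 <= bform (invmx (diagpart A)) z z.
  by rewrite -bform_invmx ?posdef_unitmx//; exact: posdef_ge0.
have HK x := bform_smoothing x As Ds Dp He Heta.
split=> [v|].
  by rewrite /mnorm !sqr_sqrtr; [exact: HK| | |]; rewrite ?iD0// posdef_ge0.
have approx x : exists mu, bform (diagpart A) (x - prol R q *m mu) (x - prol R q *m mu)
    <= 5 / 2 * bform A x x.
  have [mu Hmu] := Bh_approximation a1 a2 q2 x; exists mu.
  by rewrite diagpartZ !bformZm mulrCA ler_wpM2l// ltW.
have n0 : (0 < (2 ^ q).-1)%N by have [-> _] := grid_size q2.
apply: opnorm_le => // v v0.
have nv : 0 < mnorm A v by rewrite sqrtr_gt0; exact: Ap.
rewrite ler_pdivrMr// /mnorm.
have b0 : (0 : R) < 5 / 2 by lra.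
have := two_grid_le As Ap Ds Dp (erefl _) (@prol_inj R q q2) b0 approx v (ltW eta_gt0) HK.
have -> : 1 - eta / (5 / 2) = 1 - 2 * eta / 5 by field.
set C := Num.max _ _ => h.
(* [Num.sqrt] is [0] at negative arguments, so the maximum with [0] does not change the root. *)
have -> : Num.sqrt (1 - 2 * eta / 5) = Num.sqrt C.
  by rewrite /C; case: (leP 0 (1 - 2 * eta / 5)) => // /ltW/ler0_sqrtr ->; rewrite sqrtr0.
rewrite -sqrtrM; last by rewrite /C le_max lexx.
exact: ler_wsqrtr.
Qed.

Theorem theorem3p5 (R : realType) (a b : R) (q : nat) (eta0 w eta : R) :
  1 < a -> a < 2 -> 0 < b -> (2 <= q)%N ->
  lmax_le (invmx (diagpart (Aq a b q)) *m Aq a b q) eta0 -> eta0 < 2 ->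
  0 < w -> w < 2 / eta0 ->
  0 < eta -> eta <= w * (2 - w * eta0) ->
  (forall v : 'cV[R]_((2 ^ q).-1),
     mnorm (Aq a b q) (jacobi w (Aq a b q) *m v) ^+ 2
     <= mnorm (Aq a b q) v ^+ 2
        - eta * mnorm (invmx (diagpart (Aq a b q))) (Aq a b q *m v) ^+ 2)
  /\ opnorm (Aq a b q) (jacobi w (Aq a b q) *m cgc (Aq a b q))
       <= Num.sqrt (1 - 2 * eta / 5)
  /\ Num.sqrt (1 - 2 * eta / 5) < 1.
Proof.
move=> a1 a2 b0 q2 He _ w0 _ eta_gt0 Heta.
have sqrt_lt1 : Num.sqrt (1 - 2 * eta / 5) < 1.
  by rewrite -[X in _ < X]sqrtr1 ltr_sqrt; lra.
suff [H1 H2] : (forall v : 'cV[R]_((2 ^ q).-1),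
     mnorm (Aq a b q) (jacobi w (Aq a b q) *m v) ^+ 2
     <= mnorm (Aq a b q) v ^+ 2
        - eta * mnorm (invmx (diagpart (Aq a b q))) (Aq a b q *m v) ^+ 2)
  /\ opnorm (Aq a b q) (jacobi w (Aq a b q) *m cgc (Aq a b q))
       <= Num.sqrt (1 - 2 * eta / 5) by [].
have := Aq_coef_ge0 (b / (2 ^ q)%:R) (introT andP (conj a1 a2)).
rewrite le_eqVlt => /predU1P[c0|c0]; last first.
  exact: (two_grid_convergence a1 a2 q2 c0 He eta_gt0 Heta).
(* With coefficient [0] all [Aq]-norms vanish, so both sides of the smoothing bound are [0] and
   every quotient in the operator norm is [0]. *)
have A0 : Aq a b q = 0 by rewrite /Aq -c0 scale0r.
have norm0 n (x : 'cV[R]_n) : mnorm 0 x = 0 by rewrite /mnorm mulmx0 mul0mx mxE sqrtr0.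
have normx0 n (M : 'M[R]_n) : mnorm M 0 = 0 by rewrite /mnorm mulmx0 mxE sqrtr0.
rewrite A0; split=> [v|].
  by rewrite !norm0 mul0mx normx0 expr0n /= mulr0 subr0.
have n0 : (0 < (2 ^ q).-1)%N by have [-> _] := grid_size q2.
by apply: opnorm_le => // v _; rewrite norm0 mul0r sqrtr_ge0.
Qed.
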